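(* Let $\mathcal{N}$ be a finite set of matroids and define $k = \min_{N \in \mathcal{N}}\chi(N)-1$. Then, for all sufficiently large $n$, \[\mathrm{ex}(\mathcal{N},n) = 2^n(1-2^{-k})+\mathrm{ex}(\mathcal{D}(\mathcal{N}),n-k),\] and the extremal $n$-dimensional matroids in $\mathrm{EX}(\mathcal{N})$ (i.e. $n$-dimensional $\mathcal{N}$-free matroids of size $\mathrm{ex}(\mathcal{N},n)$) are exactly those of the form $M \cong (M_0)^{n,k}$ for some $(n-k)$-dimensional matroid $M_0$ that is extremal in $\mathrm{EX}(\mathcal{D}(\mathcal{N}))$.
   Context: A matroid of dimension $m$ is a set $M \subseteq \mathbb{F}_2^m \setminus \{0\}$; write $\dim(M)=m$. Matroids $M, M' \subseteq \mathbb{F}_2^m$ are isomorphic if a linear bijection of $\mathbb{F}_2^m$ maps $M'$ onto $M$. A subset of $M \subseteq \mathbb{F}_2^m$ that is the image of $N \subseteq \mathbb{F}_2^k$ under an injective linear map $\mathbb{F}_2^k \to \mathbb{F}_2^m$ is an $N$-restriction of $M$. For a set $\mathcal{N}$ of matroids, $M$ is $\mathcal{N}$-free if it has no $N$-restriction for any $N\in\mathcal{N}$; $\mathrm{EX}(\mathcal{N})$ is the class of $\mathcal{N}$-free matroids, $\mathrm{ex}(\mathcal{N},n)$ is the maximum size of an $n$-dimensional matroid in $\mathrm{EX}(\mathcal{N})$, and such a matroid of that size is extremal in $\mathrm{EX}(\mathcal{N})$. The critical number $\chi(N)$ of $N \subseteq \mathbb{F}_2^k$ is the smallest codimension of a subspace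 of $\mathbb{F}_2^k$ disjoint from $N$. If $N$ is a matroid with $\dim(N) \le n-t$, $N^{n,t} \subseteq \mathbb{F}_2^n$ denotes the matroid (unique up to isomorphism) for which there is a $t$-codimensional subspace $F$ of $\mathbb{F}_2^n$ such that $N^{n,t}\cap F$ is an $N$-restriction of $N^{n,t}$ and $\mathbb{F}_2^n - F \subseteq N^{n,t}$ (i.e. a copy of $N$ placed inside $F$ together with all vectors outside $F$). With $k = \min_{N\in\mathcal{N}}\chi(N)-1$, the decomposition family $\mathcal{D}(\mathcal{N})$ is the collection of (isomorphism classes of) matroids $D$ that are minimal with respect to the restriction order subject to the property that for some $N \in \mathcal{N}$, $D^{\dim(N),k}$ is defined and has an $N$-restriction. *)

(* Defs.v *)
From HB Require Import structures.
From mathcomp Require Import all_boot all_algebra.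
From mathcomp Require Import boolp classical_sets cardinality.
Set Implicit Arguments.
Unset Strict Implicit.
Unset Printing Implicit Defensive.
Import GRing.Theory.
Local Open Scope ring_scope.

Record matroid (m : nat) := Matroid {
  mset :> {set 'rV['F_2]_m};
  mset_nz : 0 \notin mset
}.

HB.instance Definition _ m := [isSub for @mset m].
HB.instance Definition _ m := [Finite of matroid m by <:].

(* Matroids of arbitrary dimension: [tag N] is dim(N). *)
Definition anyMatroid := {m : nat & matroid m}.

Definition isomorphic m (M M' : matroid m) : Prop :=
  exists f : {linear 'rV['F_2]_m -> 'rV['F_2]_m},
    bijective f /\ f @: (M' : {set _}) = M :> {set _}.

(* [X] is an [N]-restriction of [M]. *)
Definition restriction_of k m (N : matroid k) (M : matroid m)
    (X : {set 'rV['F_2]_m}) : Prop :=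
  X \subset M /\
  exists f : {linear 'rV['F_2]_k -> 'rV['F_2]_m},
    injective f /\ f @: (N : {set _}) = X.

Definition has_restriction k m (N : matroid k) (M : matroid m) : Prop :=
  exists X, restriction_of N M X.

(* Membership in EX(Ns). *)
Definition family_free (Ns : set anyMatroid) m (M : matroid m) : Prop :=
  forall N : anyMatroid, Ns N -> ~ has_restriction (tagged N) M.

(* The maximum is 0 if no [n]-dimensional matroid is [Ns]-free; this only
   happens when [Ns] has a member that is empty as a set of vectors. *)
Definition extremal_number (Ns : set anyMatroid) (n : nat) : nat :=
  \max_(M : matroid n | `[< family_free Ns M >]) #|M|.

Definition extremal (Ns : set anyMatroid) n (M : matroid n) : Prop :=
  family_free Ns M /\ #|M| = extremal_number Ns n.

Definition avoided_in_codim m (N : matroid m) (c : nat) : Prop :=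
  exists U : {vspace 'rV['F_2]_m},
    (\dim U + c)%N = m /\ forall v, v \in (N : {set _}) -> v \notin U.

Lemma avoided_in_some_codim m (N : matroid m) :
  exists c, `[< avoided_in_codim N c >].
Proof.
exists m; apply/asboolP; exists 0%VS; split; first by rewrite dimv0.
move=> v vN; rewrite memv0; apply/eqP => v0.
by move: (mset_nz N); rewrite -v0 vN.
Qed.

Definition critical_number m (N : matroid m) : nat :=
  ex_minn (avoided_in_some_codim N).

Definition is_min_critical_number (Ns : set anyMatroid) (c : nat) : Prop :=
  (exists N : anyMatroid, Ns N /\ critical_number (tagged N) = c) /\
  (forall N : anyMatroid, Ns N -> (c <= critical_number (tagged N))%N).

(* [M] is (a copy of) N^{n,t}.  The bound dim(N) <= n - t has to be explicit:
   when [N] does not span, a copy of [N] may lie in [F] although the injective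
   map producing it does not have its range inside [F]. *)
Definition is_lift m n (N : matroid m) (t : nat) (M : matroid n) : Prop :=
  (m + t <= n)%N /\
  exists F : {vspace 'rV['F_2]_n},
    [/\ (\dim F + t)%N = n,
        restriction_of N M [set v in (M : {set _}) | v \in F] &
        forall v, v \notin F -> v \in (M : {set _})].

(* D^{dim(N),k} is defined and has an [N]-restriction, for some [N] in [Ns]. *)
Definition decomposing (Ns : set anyMatroid) (k : nat) (D : anyMatroid) : Prop :=
  exists N : anyMatroid, Ns N /\
    exists L : matroid (tag N),
      is_lift (tagged D) k L /\ has_restriction (tagged N) L.

(* The decomposition family when k = min chi - 1, as an isomorphism-closed
   class; for finite matroids, mutual restriction is isomorphism, so this is
   minimality in the restriction order on isomorphism classes. *)
Definition decomposition_family (Ns : set anyMatroid) (k : nat) :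
    set anyMatroid :=
  fun D => decomposing Ns k D /\
    forall D' : anyMatroid, decomposing Ns k D' ->
      has_restriction (tagged D') (tagged D) ->
      has_restriction (tagged D) (tagged D').

(* Main.v *)
Require Import Defs.
From HB Require Import structures.
From mathcomp Require Import all_boot all_algebra.
From mathcomp Require Import ssrAC finfield zify.
From mathcomp Require Import boolp classical_sets cardinality.
Set Implicit Arguments.
Unset Strict Implicit.
Unset Printing Implicit Defensive.
Import GRing.Theory.
Local Open Scope ring_scope.

(** For large [n], a dense [M] contains a Bose-Burton geometry: subspaces [W0]
    and [Wc] with [Wc] of dimension [k] and [(W0 + Wc) \ W0] inside [M].  If [M]
    has no such geometry with [k + 1] levels, then for every complement [Wc] of
    [W0] almost all translates of [Wc] meet the complement [C] of [M]; as
    [#|C| <= 2 ^ (n - k)], almost all meet it exactly once.  So on almost all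
    translates of a fixed smaller [V0 + Wc], the set [C] is exactly one translate
    of [V0].  The part [E] of [C] in these regular translates is closed under
    those sums that are regular, again because [k + 1] levels are excluded, so
    [E + E] is a subspace [F] of codimension [k] and [C \ F] is small.  Hence a
    member of the decomposition family inside [M :&: F] would extend to a member
    of [Ns] in [M], so [M :&: F] is free of the decomposition family.  This gives
    the upper bound on [#|M|], with equality only if [M] contains the complement
    of [F]; lifts show that the bound is attained. *)

(** * Subspaces and translates *)

Section Subspaces.
Variable n : nat.
Implicit Types (u v w x y : 'rV['F_2]_n) (U W G T : {vspace 'rV['F_2]_n}).
Implicit Types (A B C Q M : {set 'rV['F_2]_n}).

Lemma addvv2 v : v + v = 0.
Proof. by rewrite -mulr2n -scaler_nat pchar_Zp // scale0r. Qed.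

Lemma addKv2 v w : v + w + w = v.
Proof. by rewrite -addrA addvv2 addr0. Qed.

Lemma F2P (a : 'F_2) : a = 0 \/ a = 1.
Proof. by case: a => -[|[|//]] i; [left|right]; apply/val_inj. Qed.

Lemma card_subspace U : #|[set v | v \in U]| = (2 ^ \dim U)%N.
Proof. by rewrite cardsE card_vspace card_Fp. Qed.

Lemma card_F2n : #|[set: 'rV['F_2]_n]| = (2 ^ n)%N.
Proof. by rewrite cardsT card_mx card_Fp // mul1n. Qed.

Lemma dimvf_rV : \dim {: 'rV['F_2]_n} = n.
Proof. by rewrite dimvf /dim /= mul1n. Qed.

Lemma card_translate A v : #|[set x | x + v \in A]| = #|A|.
Proof.
rewrite -(card_imset A (addIr v)); apply: eq_card => x; rewrite inE.
apply/idP/imsetP => [xA|[y yA ->]]; last by rewrite addKv2.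
by exists (x + v); rewrite ?addKv2.
Qed.

Lemma mem_add_line v U w :
  w \in (U + <[v]>)%VS -> w \in U \/ exists2 u, u \in U & w = u + v.
Proof.
case/memv_addP => u uU [t /vlineP [a ->] ->].
case: (F2P a) => ->; first by left; rewrite scale0r addr0.
by right; exists u; rewrite ?scale1r.
Qed.

Lemma dim_add_line v U : v \notin U -> \dim (U + <[v]>) = (\dim U).+1.
Proof.
move=> vU; rewrite dimv_disjoint_sum.
  rewrite dim_vline; case: eqP vU => [->|_ _]; first by rewrite mem0v.
  by rewrite addn1.
apply/eqP; rewrite -subv0; apply/subvP => w /memv_capP [wU /vlineP [a Ew]].
move: vU wU; rewrite Ew.
by case: (F2P a) => ->; rewrite ?scale0r ?mem0v // scale1r => /negP.
Qed.

Lemma capv0P U W :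
  (U :&: W = 0)%VS <-> forall v, v \in U -> v \in W -> v = 0.
Proof.
split=> [UW v vU vW|UW].
  by apply/eqP; rewrite -memv0 -UW memv_cap vU.
apply/eqP; rewrite -subv0; apply/subvP => w /memv_capP [wU wW].
by rewrite memv0 (UW w).
Qed.

Lemma exists_subspace U d :
  (d <= \dim U)%N -> exists2 W, (W <= U)%VS & \dim W = d.
Proof.
elim: d => [|d IH] dU; first by exists 0%VS; rewrite ?sub0v ?dimv0.
have [W WU dW] := IH (ltnW dU).
have /subvPn [v vU vW] : ~~ (U <= W)%VS.
  by apply: contraL dU => /dimvS; rewrite dW -leqNgt.
exists (W + <[v]>)%VS; last by rewrite dim_add_line ?dW.
by rewrite subv_add WU -memvE.
Qed.

(** Since [v = - v], this is the intersection of [A] with its translate by [v]: its size counts the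
    ordered pairs of [A] with difference [v]. *)
Definition shift_cap A v := [set x in A | x + v \in A].

Lemma in_shift_cap A v x : (x \in shift_cap A v) = (x \in A) && (x + v \in A).
Proof. by rewrite inE. Qed.

Lemma sum_shift_cap A U : (forall x, x \in A -> x \in U) ->
  (\sum_(v in [set v | v \in U]) #|shift_cap A v| = #|A| * #|A|)%N.
Proof.
move=> AU; under eq_bigr do rewrite -sum1_card big_mkcond /=.
rewrite exchange_big /= -sum_nat_const [RHS]big_mkcond /=.
apply: eq_bigr => x _; case: ifP => xA; last first.
  rewrite big1 // => v _. by rewrite in_shift_cap xA.
rewrite -big_mkcondr /= sum1_card -[RHS](card_translate _ x).
apply: eq_card => v; rewrite [LHS]unfold_in /= in_shift_cap !inE xA /= addrC.
apply: andb_idl => vxA; have := memvD (AU _ vxA) (AU _ xA).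
by rewrite addKv2.
Qed.

(* The popular difference [h]: the pairs of [Q] whose difference is in [T] are
   too few to account for the |Q|^2 pairs. *)
Lemma popular_difference (a : nat) W T Q :
  (T <= W)%VS -> (forall x, x \in Q -> x \in W) ->
  (2 ^ \dim W <= a * #|Q|)%N -> (2 * 2 ^ \dim T * a < 2 ^ \dim W)%N ->
  exists h, [/\ h \in W, h \notin T &
    (2 ^ \dim W <= 2 * a ^ 2 * #|shift_cap Q h|)%N].
Proof.
move=> TW QW aQ aT.
have [//|noh] := pselect (exists h, [/\ h \in W, h \notin T &
    (2 ^ \dim W <= 2 * a ^ 2 * #|shift_cap Q h|)%N]).
have := sum_shift_cap QW; rewrite (bigID (fun v => v \in T)) /=.
set s1 := (\sum_(i in _ | _) _)%N; set s2 := (\sum_(i in _ | _) _)%N => E.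
have le1 : (s1 <= 2 ^ \dim T * #|Q|)%N.
  rewrite -card_subspace -sum_nat_const /s1.
  rewrite [leqLHS](eq_bigl (mem [set v | v \in T])) /=.
    apply: leq_sum => v _; apply/subset_leq_card/fintype.subsetP => x.
    by rewrite in_shift_cap => /andP [].
  by move=> v; rewrite !inE andbC; apply: andb_idr => /(subvP TW).
have le2 : (2 * a ^ 2 * s2 <= 2 ^ \dim W * 2 ^ \dim W)%N.
  rewrite -[X in (_ <= X * _)%N]card_subspace big_distrr /= -sum_nat_const.
  rewrite big_mkcondr /=; apply: leq_sum => v; rewrite inE => vW.
  case: ifPn => // vT; rewrite leqNgt; apply/negP => /ltnW lev.
  by apply: noh; exists v.
(* Now [2 a^2 |Q|^2 = 2 a^2 (s1 + s2)], while [2 a^2 s1 < a w |Q| <= a^2 |Q|^2] and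
   [2 a^2 s2 <= w^2 <= a^2 |Q|^2]. *)
clearbody s1 s2; move: (2 ^ _)%N (2 ^ _)%N #|Q| => t w q in E aQ aT le1 le2 *.
nia.
Qed.
End Subspaces.

(** Induction on [d]: a popular difference [h] outside [T] replaces [Q] by [shift_cap Q h], with
    [2 * a ^ 2] in place of [a]; then [h] joins [T], which keeps the remaining directions
    independent of it. *)
Lemma exists_affine_cube (d a e : nat) : exists N : nat,
  forall n (W T : {vspace 'rV['F_2]_n}) (Q : {set 'rV['F_2]_n}),
    (T <= W)%VS -> (\dim T <= e)%N -> (N <= \dim W)%N ->
    (forall x, x \in Q -> x \in W) -> (2 ^ \dim W <= a * #|Q|)%N ->
  exists p (G : {vspace 'rV['F_2]_n}),
    [/\ (G <= W)%VS, \dim G = d, (G :&: T = 0)%VS &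
        forall g, g \in G -> p + g \in Q].
Proof.
elim: d a e => [|d IH] a e.
  exists 0%N => n W T Q TW _ _ QW aQ.
  have /card_gt0P [p pQ] : (0 < #|Q|)%N.
    by rewrite lt0n; apply: contraTneq aQ => ->; rewrite muln0 -ltnNge expn_gt0.
  exists p, 0%VS; split; rewrite ?sub0v ?dimv0 ?cap0v //.
  by move=> g; rewrite memv0 => /eqP ->; rewrite addr0.
have [N0 HN] := IH (2 * a ^ 2)%N e.+1.
(* The term [(a + e).+2] secures the dimension gap that [popular_difference] requires, by
   [a < 2 ^ a]. *)
exists (maxn N0 (a + e).+2) => n W T Q TW Te; rewrite geq_max => /andP [NW aeW] QW aQ.
have aT : (2 * 2 ^ \dim T * a < 2 ^ \dim W)%N.
  rewrite -expnS; apply: (@leq_trans (2 ^ (a + e).+2)); last by rewrite leq_exp2l.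
  have -> : ((a + e).+2 = a + e.+2)%N by lia.
  rewrite [ltnLHS]mulnC expnD; apply: ltn_mul; first exact: ltn_expl.
  by rewrite ltn_exp2l.
have [h [hW hT hQ]] := popular_difference TW QW aQ aT.
have [|||x|//|p [G [GW dG GT HG]]] := HN n W (T + <[h]>)%VS (shift_cap Q h).
- by rewrite subv_add TW -memvE.
- by rewrite dim_add_line.
- by [].
- by rewrite in_shift_cap => /andP [/QW].
have hG : h \notin G.
  apply: contra hT => hG; have/capv0P/(_ h hG) := GT.
  by rewrite (subvP (addvSr _ _) _ (memv_line h)) => ->; rewrite ?mem0v.
exists p, (G + <[h]>)%VS; split.
- by rewrite subv_add GW -memvE.
- by rewrite dim_add_line ?dG.
- apply/capv0P => v /mem_add_line [vG|[g gG ->]] vT.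
    by move/capv0P: GT; apply => //; apply: (subvP (addvSl _ _)).
  have g0 : g = 0.
    move/capv0P: GT; apply => //; rewrite -[g](addKv2 _ h).
    by apply: memv_add; rewrite ?memv_line.
  by move: hT; rewrite -(add0r h) -{1}g0 vT.
- move=> g /mem_add_line [/HG|[g' /HG + ->]]; rewrite in_shift_cap => /andP [] //.
  by rewrite addrA.
Qed.

(** * Bose-Burton geometries in dense sets *)

(** For [j = \dim Wc], a space minus a subspace [W0] of codimension [j] is the Bose-Burton geometry
    with [j] levels. The complement [Wc] is recorded because the counting runs over its
    translates. *)
Definition bose_burton_in n (M : {set 'rV['F_2]_n})
    (W0 Wc : {vspace 'rV['F_2]_n}) :=
  (W0 :&: Wc = 0)%VS /\
  forall v, v \in (W0 + Wc)%VS -> v \notin W0 -> v \in M.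

Definition has_bose_burton n (M : {set 'rV['F_2]_n}) (j d : nat) :=
  exists W0 Wc : {vspace 'rV['F_2]_n},
    [/\ bose_burton_in M W0 Wc, \dim W0 = d & \dim Wc = j].

Definition full_translates n (M : {set 'rV['F_2]_n}) (U : {vspace 'rV['F_2]_n}) :=
  [set x | [forall w, (w \in U) ==> (x + w \in M)]].

Lemma full_translatesP n (M : {set 'rV['F_2]_n}) (U : {vspace 'rV['F_2]_n}) x :
  reflect (forall w, w \in U -> x + w \in M) (x \in full_translates M U).
Proof.
by rewrite inE; apply: (iffP forallP) => H w; [have /implyP := H w|apply/implyP => /H].
Qed.

Lemma bose_burton_sub n (M : {set 'rV['F_2]_n})
    (W0 Wc G U : {vspace 'rV['F_2]_n}) :
  (G <= W0)%VS -> (U <= Wc)%VS -> bose_burton_in M W0 Wc -> bose_burton_in M G U.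
Proof.
move=> GW0 UWc [/capv0P W0c BB]; split.
  by apply/capv0P => v /(subvP GW0) vW /(subvP UWc); apply: W0c.
move=> v vGU vG; apply: BB; first by rewrite (subvP (addvS GW0 UWc)).
have /memv_addP [g gG [u uU Ev]] := vGU.
apply: contra vG => vW0; rewrite Ev; suff -> : u = 0 by rewrite addr0.
apply: W0c; last exact: (subvP UWc).
have -> : u = v + g by rewrite Ev addrC addrA addvv2 add0r.
by rewrite rpredD // (subvP GW0).
Qed.

Lemma bose_burton_add_line n (M : {set 'rV['F_2]_n})
    (W0 Wc : {vspace 'rV['F_2]_n}) x :
  0 \notin M -> bose_burton_in M W0 Wc ->
  (forall g w, g \in W0 -> w \in Wc -> x + g + w \in M) ->
  bose_burton_in M W0 (Wc + <[x]>)%VS /\ \dim (Wc + <[x]>) = (\dim Wc).+1.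
Proof.
move=> M0 [/capv0P W0c BB] inM.
have xW : x \notin (W0 + Wc)%VS.
  apply: contra M0 => /memv_addP [g gG [w wW Ex]].
  by rewrite -(addvv2 x) {2}Ex addrA inM.
split; last by rewrite dim_add_line //; apply: contra xW; apply: (subvP (addvSr _ _)).
split.
  apply/capv0P => v vG /mem_add_line [vW|[w wW Ev]]; first exact: W0c.
  case/negP: xW; rewrite -(addKv2 x w) addrAC (addrC x) -Ev.
  exact: memv_add.
move=> v; rewrite addvA => /mem_add_line [vGW|[u /memv_addP [g gG [w wW ->]] ->]] vG.
  exact: BB.
by rewrite addrC addrA inM.
Qed.

(** An affine subspace [x + G] of base points of full translates makes [x] a new level, at the price
    of shrinking [W0] to [G]. *)
Lemma bose_burton_extend n (M : {set 'rV['F_2]_n})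
    (W0 Wc G : {vspace 'rV['F_2]_n}) x :
  0 \notin M -> bose_burton_in M W0 Wc -> (G <= W0)%VS ->
  (forall g, g \in G -> x + g \in full_translates M Wc) ->
  has_bose_burton M (\dim Wc).+1 (\dim G).
Proof.
move=> M0 BB GW0 HG; exists G, (Wc + <[x]>)%VS.
have [||//] := @bose_burton_add_line _ M G Wc x M0.
  exact: bose_burton_sub BB.
by move=> g w gG wW; have /full_translatesP := HG g gG; apply.
Qed.

(** Each point of [C] lies in [x + U] for exactly [2 ^ \dim U] choices of [x]. *)
Lemma card_meet_translates n (C : {set 'rV['F_2]_n}) (U : {vspace 'rV['F_2]_n}) :
  (\sum_(x : 'rV['F_2]_n) #|[set w | (w \in U) && (x + w \in C)%R]| = 2 ^ \dim U * #|C|)%N.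
Proof.
under eq_bigr do rewrite -sum1_card big_mkcond /=.
rewrite exchange_big /= -card_subspace -sum_nat_const [RHS]big_mkcond /=.
apply: eq_bigr => p _; rewrite inE; case: ifP => pW; last first.
  by rewrite big1 // => u _; rewrite inE pW.
rewrite -big_mkcond /= sum1_card -[RHS](card_translate _ p).
apply: eq_card => u; rewrite inE.
transitivity (p \in [set w | (w \in U) && (u + w \in C)]) => //.
by rewrite inE pW.
Qed.

(** If full translates were dense, they would be dense on some coset of [W0]; an affine cube there
    would add a level by [bose_burton_extend]. *)
Lemma card_full_translates (d a : nat) : exists N : nat,
  forall n (M : {set 'rV['F_2]_n}) (W0 Wc : {vspace 'rV['F_2]_n}),
    0 \notin M -> bose_burton_in M W0 Wc -> (N <= \dim W0)%N ->
    ~ has_bose_burton M (\dim Wc).+1 d ->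
  (a * #|full_translates M Wc| <= 2 ^ n)%N.
Proof.
have [N HN] := exists_affine_cube d a 0.
exists N => n M W0 Wc M0 BB NW noBB; set B := full_translates M Wc.
have HQ u : (a * #|[set p | (p \in W0) && (u + p \in B)%R]| <= 2 ^ \dim W0)%N.
  rewrite leqNgt; apply/negP => /ltnW aQ; apply: noBB.
  have [|x|p [G [GW <- _ HG]]] := HN n W0 0%VS _ (sub0v _) _ NW _ aQ.
  - by rewrite dimv0.
  - by rewrite inE => /andP [].
  apply: (bose_burton_extend (x := u + p) M0 BB GW) => g /HG.
  by rewrite inE => /andP [_]; rewrite addrA.
have : (a * \sum_(u : 'rV['F_2]_n) #|[set p | (p \in W0) && (u + p \in B)%R]|
   <= 2 ^ n * 2 ^ \dim W0)%N.
  rewrite -card_F2n cardsT -sum_nat_const big_distrr /=.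
  by apply: leq_sum => u _; apply: HQ.
by rewrite card_meet_translates mulnCA (mulnC (2 ^ n)%N) leq_pmul2l ?expn_gt0.
Qed.

(** Induction on [j]. If one more level is impossible, at most a third of the translates of [Wc] are
    full, so at least two thirds meet the complement of [M]; by double counting the density
    hypothesis allows at most half. *)
Lemma dense_has_bose_burton (j d : nat) : exists N : nat,
  forall n (M : {set 'rV['F_2]_n}), (N <= n)%N -> 0 \notin M ->
    (2 ^ j * #|~: M| <= 2 ^ n)%N -> has_bose_burton M j d.
Proof.
elim: j d => [|j IH] d.
  exists d => n M dn _ _.
  have /exists_subspace [W _ dW] : (d <= \dim {: 'rV['F_2]_n})%N by rewrite dimvf_rV.
  exists W, 0%VS; split; rewrite ?dimv0 //; split; first exact: capv0.
  by move=> v; rewrite addv0 => ->.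
have [D HD] := card_full_translates d 3.
have [N HN] := IH D.
exists N => n M Nn M0 CM.
have [|W0 [Wc [BB dW0 dWc]]] := HN n M Nn M0.
  by apply: leq_trans CM; rewrite leq_mul2r leq_exp2l // leqnSn orbT.
have [//|noBB] := pselect (has_bose_burton M j.+1 d).
have := HD n M W0 Wc M0 BB; rewrite dW0 dWc => /(_ (leqnn _) noBB).
have : (#|~: full_translates M Wc| <= 2 ^ j * #|~: M|)%N.
  rewrite -dWc -card_meet_translates -sum1_card big_mkcond /=.
  apply: leq_sum => x _; case: ifP => //; rewrite inE => /full_translatesP Hx.
  rewrite card_gt0; apply/set0Pn; apply: contrapT => Hx'; apply: Hx => w wW.
  by apply/negPn/negP => xw; apply: Hx'; exists w; rewrite !inE wW.
have := cardsC (full_translates M Wc); rewrite -cardsT card_F2n.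
move: CM; rewrite expnS; have := expn_gt0 2 n.
move: (2 ^ n)%N (2 ^ j)%N => q t; nia.
Qed.

Lemma leq_card_bigcup (I T : finType) (P : pred I) (S : I -> {set T}) :
  (#|\bigcup_(i | P i) S i| <= \sum_(i | P i) #|S i|)%N.
Proof.
elim/big_rec2: _ => [|i m A _ lemA]; first by rewrite cards0.
by rewrite (leq_trans (leq_card_setU _ _)) // leq_add2l.
Qed.

(** Adding [w] to a complement [X] of [W0 + <[w]>] brings an arbitrary [w] outside [W0] into the
    reach of [card_shift_cap_le]. *)
Lemma bose_burton_change_complement n (M : {set 'rV['F_2]_n})
    (W0 Wc : {vspace 'rV['F_2]_n}) w :
  bose_burton_in M W0 Wc -> w \in (W0 + Wc)%VS -> w \notin W0 ->
  exists Wc' : {vspace 'rV['F_2]_n},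
    [/\ bose_burton_in M W0 Wc', \dim Wc' = \dim Wc & w \in Wc'].
Proof.
move=> [W0c BB] wW wW0; set X := ((W0 + Wc) :\: (W0 + <[w]>))%VS.
have EW : (W0 + (X + <[w]>) = W0 + Wc)%VS.
  rewrite addvC -addvA (addvC <[w]>%VS) addv_diff; apply/addv_idPl.
  by rewrite subv_add addvSl -memvE.
have wX : w \notin X.
  have /capv0P capX := capv_diff (W0 + Wc)%VS (W0 + <[w]>)%VS.
  apply/negP => /capX w0; move: wW0; rewrite w0 ?mem0v //.
  exact: (subvP (addvSr _ _) _ (memv_line w)).
have dW : (\dim W0 + \dim Wc = \dim W0 + (\dim X).+1)%N.
  rewrite -dimv_disjoint_sum // -(addv_idPl (_ : (W0 + <[w]> <= W0 + Wc)%VS)).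
    rewrite -addv_diff dimv_disjoint_sum ?capv_diff // dim_add_line //.
    by rewrite addnC addSnnS.
  by rewrite subv_add addvSl -memvE.
have dX : \dim (X + <[w]>) = \dim Wc by rewrite dim_add_line //; lia.
exists (X + <[w]>)%VS; split; first split.
- apply/eqP; rewrite -dimv_eq0; apply/eqP.
  have := dimv_sum_cap W0 (X + <[w]>)%VS; rewrite EW dX.
  by rewrite (dimv_disjoint_sum W0c); lia.
- by rewrite EW.
- by [].
- exact: (subvP (addvSr _ _) _ (memv_line w)).
Qed.

(** On average a translate of [U] has at most one point outside [M]. If [x] and [x + w] are both
    outside, then [x + U] has at least two, and full translates must make up for the excess. *)
Lemma card_shift_cap_le n (M : {set 'rV['F_2]_n}) (U : {vspace 'rV['F_2]_n}) w :
  (2 ^ \dim U * #|~: M| <= 2 ^ n)%N -> w \in U -> w != 0 ->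
  (#|shift_cap (~: M) w| <= #|full_translates M U|)%N.
Proof.
move=> CM wU w0; set B := full_translates M U; set S := shift_cap _ w.
suff : (#|~: B| + #|S| <= 2 ^ n)%N.
  by have := cardsC B; rewrite -cardsT card_F2n; lia.
apply: leq_trans CM; rewrite -card_meet_translates -!sum1_card.
rewrite big_mkcond [in X in (_ + X)%N]big_mkcond -big_split /=.
apply: leq_sum => x _; rewrite in_shift_cap !finset.in_setC.
case: (boolP (x \in M)) => xM /=.
  rewrite addn0; case: ifP => // /full_translatesP Hx.
  rewrite card_gt0; apply/set0Pn; apply: contrapT => Hx'; apply: Hx => v vU.
  by apply/negPn/negP => xv; apply: Hx'; exists v; rewrite !inE vU.
case: (boolP (x + w \in M)) => xwM /=.
  rewrite addn0; case: ifP => // _; rewrite card_gt0; apply/set0Pn.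
  by exists 0; rewrite !inE mem0v addr0.
apply: (@leq_trans #|[set w; 0]|); first by rewrite cards2 w0; case: ifP.
apply: subset_leq_card; apply/fintype.subsetP => v.
by rewrite !inE => /orP [] /eqP ->; rewrite ?wU ?mem0v ?addr0.
Qed.

Lemma closed_set_vspace n (A : {set 'rV['F_2]_n}) :
  0 \in A -> {in A &, forall u v, u + v \in A} ->
  exists F : {vspace 'rV['F_2]_n}, forall v, (v \in F) = (v \in A).
Proof.
move=> A0 AD; exists <<enum A>>%VS => v; apply/idP/idP => [|vA]; last first.
  by apply: memv_span; rewrite mem_enum.
have : {subset enum A <= A} by move=> u; rewrite mem_enum.
elim: (enum A) v => [|x X IH] v XA; first by rewrite span_nil memv0 => /eqP ->.
have xA : x \in A by rewrite XA ?mem_head.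
have {}IH u : u \in <<X>>%VS -> u \in A.
  by apply: IH => y yX; rewrite XA // inE yX orbT.
rewrite span_cons addvC => /mem_add_line [/IH //|[u /IH uA ->]].
exact: AD.
Qed.

(** * Stability *)

Section ApproximateSubspace.
Variables (n r : nat) (E : {set 'rV['F_2]_n}).
Let defect v := #|[set y in E | y + v \notin E]|.
Hypothesis defectE : forall x, x \in E -> (defect x <= r)%N.
Hypothesis r_small : (4 * r < #|E|)%N.

(** If [y] is in [E] and [y + (u + v)] is not, then either [y + u] is already outside [E], or it is
    in [E] and [v] moves it out. *)
Let defectD u v : (defect (u + v)%R <= defect u + defect v)%N.
Proof.
rewrite /defect -[X in (_ <= _ + X)%N](card_translate _ u).
apply: leq_trans (leq_card_setU _ _); apply: subset_leq_card.
apply/fintype.subsetP => y; rewrite !inE addrA => /andP [-> ->].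
by rewrite andbT orNb.
Qed.

Let defect_small v : (defect v < #|E|)%N -> exists2 y, y \in E & y + v \in E.
Proof.
move=> dv; apply: contrapT => noy; move: dv; rewrite ltnNge => /negP; apply.
apply: subset_leq_card; apply/fintype.subsetP => y yE; rewrite inE yE /=.
by apply/negP => yvE; apply: noy; exists y.
Qed.

(** Differences of points of [E] have defect at most [2 * r], so a sum of two of them has defect at
    most [4 * r < #|E|] and is a difference again. *)
Lemma approximate_subspace : exists F : {vspace 'rV['F_2]_n},
  (forall x, x \in E -> x \in F) /\
  (forall v, v \in F -> exists2 y, y \in E & y + v \in E).
Proof.
pose A := [set v | [exists y, (y \in E) && (y + v \in E)]].
have AP v : reflect (exists2 y, y \in E & y + v \in E) (v \in A).
  rewrite inE; apply: (iffP existsP) => [[y /andP []]|[y yE yvE]]; first by exists y.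
  by exists y; rewrite yE.
have dA v : v \in A -> (defect v <= 2 * r)%N.
  case/AP => y yE yvE; have -> : v = y + (y + v) by rewrite addrA addvv2 add0r.
  by have := defectD y (y + v); have := defectE yE; have := defectE yvE; lia.
have EA x : x \in E -> x \in A.
  by move=> xE; apply/AP/defect_small; have := defectE xE; lia.
have [||F FA] := @closed_set_vspace n A.
- have /card_gt0P [x xE] : (0 < #|E|)%N by lia.
  by apply/AP; exists x; rewrite ?addr0.
- move=> u v /dA du /dA dv; apply/AP/defect_small.
  by have := defectD u v; lia.
by exists F; split => [x /EA|v]; rewrite FA // => /AP.
Qed.
End ApproximateSubspace.

Section Regular.
Variables (n : nat) (M : {set 'rV['F_2]_n}) (V0 Wc : {vspace 'rV['F_2]_n}).
Hypothesis M0 : 0 \notin M.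
Hypothesis BB : bose_burton_in M V0 Wc.
Hypothesis noBB : ~ has_bose_burton M (\dim Wc).+1 (\dim V0).

(* On a regular translate of [V0 + Wc], the complement of [M] is a single
   translate of [V0]. *)
Definition regular x :=
  (forall w1 w2, w1 \in (V0 + Wc)%VS -> w2 \in (V0 + Wc)%VS ->
     x + w1 \notin M -> x + w2 \notin M -> w1 + w2 \in V0) /\
  (forall w1, w1 \in (V0 + Wc)%VS -> x + w1 \notin full_translates M Wc).

Definition regular_set := [set x | `[< regular x >]].

Lemma regular_setP x : reflect (regular x) (x \in regular_set).
Proof. by rewrite inE; apply: asboolP. Qed.

Lemma regular_translate x w : w \in (V0 + Wc)%VS ->
  x \in regular_set -> x + w \in regular_set.
Proof.
move=> wW /regular_setP [Ha Hb]; apply/regular_setP; split.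
  move=> w1 w2 w1W w2W xw1 xw2; have := Ha _ _ (memvD wW w1W) (memvD wW w2W).
  rewrite !addrA => /(_ xw1 xw2).
  by rewrite [w + w1 + w]addrAC addvv2 add0r.
by move=> w1 w1W; rewrite -addrA Hb // rpredD.
Qed.

Lemma regular_meets x : x \in regular_set ->
  exists2 w, w \in Wc & x + w \notin M.
Proof.
case/regular_setP => _ /(_ 0 (mem0v _)); rewrite addr0 => /full_translatesP Hx.
apply: contrapT => Hx'; apply: Hx => w wW.
by apply/negPn/negP => xw; apply: Hx'; exists w.
Qed.

(* Otherwise [x + c], [y + c] and a complement of [c] in [Wc] would span a
   Bose-Burton geometry with one more level. *)
Lemma regular_addition x y :
  x \in regular_set -> y \in regular_set -> x + y \in regular_set ->
  x \notin M -> y \notin M -> x + y \notin M.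
Proof.
move=> Rx Ry Rxy xM yM; apply/negP => xyM; apply: noBB.
have [c cW xyc] := regular_meets Rxy.
have c0 : c != 0 by apply: contraNneq xyc => ->; rewrite addr0.
have [capW _] := BB; have /capv0P capW' := capW.
(* Passing from [Wc] to [Z] loses one level; the directions [x + c] and [y + c] add two. *)
set Z := (Wc :\: <[c]>)%VS.
have ZW : (Z <= Wc)%VS := diffvSl _ _.
have cZ : c \notin Z.
  apply/negP => cZ; have /capv0P/(_ c cZ (memv_line c)) := capv_diff Wc <[c]>%VS.
  exact/eqP.
have dZ : \dim Wc = (\dim Z).+1.
  rewrite -(dimv_cap_compl Wc <[c]>) (capv_idPr _) -?memvE // dim_vline c0.
  by rewrite add1n.
have cVZ g z : g \in V0 -> z \in Z -> c + g + z \notin V0.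
  move=> gV zZ; apply/negP => cgz; case/negP: cZ.
  suff : c + z = 0 by move/eqP; rewrite addr_eq0 => /eqP ->; rewrite rpredN.
  apply: capW'; last by rewrite rpredD // (subvP ZW).
  by rewrite -(addKv2 (c + z) g) addrAC rpredD // addrAC.
have cgzW g z : g \in V0 -> z \in Z -> c + g + z \in (V0 + Wc)%VS.
  move=> gV zZ; rewrite (addrC c) -addrA memv_add // rpredD //.
  exact: (subvP ZW).
(* As [u] is regular and itself outside [M], the points outside [M] in its translate differ from [u]
   by vectors of [V0], and [c + g + z] is not in [V0]. *)
have inM u : u \in regular_set -> u \notin M ->
    forall g z, g \in V0 -> z \in Z -> u + c + g + z \in M.
  move=> /regular_setP [Hu _] uM g z gV zZ; apply/negPn/negP => ucgz.
  have := Hu 0 (c + g + z); rewrite addr0 add0r mem0v cgzW // !addrA.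
  by move=> /(_ isT isT uM ucgz); apply/negP/cVZ.
have inMxy g z : g \in V0 -> z \in Z -> x + y + g + z \in M.
  move=> gV zZ; apply/negPn/negP => xygz.
  have /regular_setP [Hxy _] := Rxy; have := Hxy c (g + z).
  rewrite !addrA (subvP (addvSr _ _) _ cW) memv_add ?(subvP ZW) //.
  by move=> /(_ isT isT xyc xygz); apply/negP/cVZ.
have [BB1 d1] := @bose_burton_add_line _ M V0 Z (x + c) M0
  (bose_burton_sub (subvv _) ZW BB) (inM x Rx xM).
have [|BB2 d2] := @bose_burton_add_line _ M V0 _ (y + c) M0 BB1.
  move=> g w gV /mem_add_line [wZ|[z zZ ->]]; first exact: inM.
  (* The two new directions sum to [x + y], since [c] cancels. *)
  suff -> : y + c + g + (z + (x + c)) = x + y + g + z by apply: inMxy.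
  by rewrite [LHS](AC (3*(1*2)) ((5*1*3*4)*(2*6))) /= addvv2 addr0.
by exists V0, (Z + <[x + c]> + <[y + c]>)%VS; rewrite d2 d1 dZ.
Qed.
End Regular.

Lemma card_irregular n (a : nat) (M : {set 'rV['F_2]_n})
    (V0 Wc : {vspace 'rV['F_2]_n}) :
  (a * #|full_translates M Wc| <= 2 ^ n)%N ->
  (forall w, w \in (V0 + Wc)%VS -> w \notin V0 ->
     (a * #|shift_cap (~: M) w| <= 2 ^ n)%N) ->
  (a * #|~: regular_set M V0 Wc|
     <= 2 ^ \dim (V0 + Wc) * 2 ^ \dim (V0 + Wc) * 2 ^ n)%N.
Proof.
move=> aB aS; set W := (V0 + Wc)%VS in aS *.
(* For a union bound over pairs [w1], [w], one family covers both failures: indices in [V0] record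
   full translates of [Wc], the others record two points outside [M] that differ by [w]. *)
pose S w := if w \in V0 then full_translates M Wc else shift_cap (~: M) w.
have aSw w : w \in W -> (a * #|S w| <= 2 ^ n)%N.
  by move=> wW; rewrite /S; case: ifPn => // wV; apply: aS.
have sub : ~: regular_set M V0 Wc \subset
    \bigcup_(w1 in [set v | v \in W]) \bigcup_(w in [set v | v \in W])
      [set x | x + w1 \in S w].
  apply/fintype.subsetP => x; rewrite finset.in_setC => /regular_setP irr.
  apply: contrapT => /negP xU.
  have xS w1 w : w1 \in W -> w \in W -> x + w1 \notin S w.
    move=> w1W wW; apply: contra xU => xw1; apply/finset.bigcupP.
    by exists w1; rewrite ?inE //; apply/finset.bigcupP; exists w; rewrite ?inE.
  apply: irr; split=> [w1 w2 w1W w2W x1 x2|w1 w1W].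
    apply/negPn/negP => w12; have := xS w1 _ w1W (memvD w1W w2W).
    rewrite /S (negPf w12) in_shift_cap !finset.in_setC x1.
    by rewrite addrA addKv2 x2.
  by have := xS w1 0 w1W (mem0v _); rewrite /S mem0v.
apply: (@leq_trans (a * \sum_(w1 in [set v | v \in W])
   #|\bigcup_(w in [set v | v \in W]) [set x | (x + w1)%R \in S w]|)).
  by rewrite leq_mul2l (leq_trans (subset_leq_card sub) (leq_card_bigcup _ _)) orbT.
rewrite -[X in (X * _ * _)%N]card_subspace -mulnA -sum_nat_const big_distrr /=.
apply: leq_sum => w1; rewrite inE => w1W.
apply: (@leq_trans (a * \sum_(w in [set v | v \in W]) #|[set x | (x + w1)%R \in S w]|)).
  by rewrite leq_mul2l leq_card_bigcup orbT.
rewrite -card_subspace -sum_nat_const big_distrr /=; apply: leq_sum => w.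
by rewrite inE => wW; rewrite card_translate aSw.
Qed.

Lemma stability (k d b : nat) : exists N : nat,
  forall n (M : {set 'rV['F_2]_n}), (N <= n)%N -> 0 \notin M ->
    (2 ^ k * #|~: M| <= 2 ^ n)%N -> ~ has_bose_burton M k.+1 d ->
  exists F : {vspace 'rV['F_2]_n}, (\dim F + k)%N = n /\
    (b * #|[set v | (v \notin M) && (v \notin F)]| <= 2 ^ n)%N.
Proof.
(* The summand [b] serves the final bound, and [8 * 2 ^ k] makes the number [r] of irregular points
   small enough for [4 * r < #|E|]. The factor squared below pays for the union bound in
   [card_irregular]. *)
pose b' := (b + 8 * 2 ^ k)%N.
have [D HD] := card_full_translates d (b' * (2 ^ (d + k) * 2 ^ (d + k)))%N.
have [N HN] := dense_has_bose_burton k (maxn D d).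
exists N => n M Nn M0 CM noBB.
have [W0 [Wc [BB dW0 dWc]]] := HN n M Nn M0 CM.
have /exists_subspace [V0 V0W dV0] : (d <= \dim W0)%N by rewrite dW0 leq_maxr.
have BBV := bose_burton_sub V0W (subvv Wc) BB.
have [/capv0P cap0 _] := BBV; have [/capv0P capW _] := BB.
have aB Wc' : bose_burton_in M W0 Wc' -> \dim Wc' = k ->
    (b' * (2 ^ (d + k) * 2 ^ (d + k)) * #|full_translates M Wc'| <= 2 ^ n)%N.
  by move=> BB' dWc'; apply: HD BB' _ _; rewrite ?dWc' // dW0 leq_maxl.
have := @card_irregular n _ M V0 Wc (aB _ BB dWc).
set R := regular_set M V0 Wc => HR; set r := #|~: R|.
have br : (b' * r <= 2 ^ n)%N.
  have dVW : \dim (V0 + Wc) = (d + k)%N.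
    by rewrite dimv_disjoint_sum ?dV0 ?dWc //; case: BBV.
  rewrite dVW in HR.
  rewrite -(@leq_pmul2l (2 ^ (d + k) * 2 ^ (d + k))) ?muln_gt0 ?expn_gt0 //.
  rewrite mulnA [X in (X * r)%N]mulnC; apply: HR => w wVW wV.
  have wW : w \in (W0 + Wc)%VS by apply: (subvP (addvS V0W (subvv Wc))).
  have wW0 : w \notin W0.
    apply: contra wV => wW0; have /memv_addP [v vV [u uW Ew]] := wVW.
    suff u0 : u = 0 by rewrite Ew u0 addr0.
    apply: capW => //; have -> : u = w + v by rewrite Ew addrC addrA addvv2 add0r.
    by rewrite rpredD // (subvP V0W).
  (* The bound [aB] holds for every such complement of dimension [k], in particular for one through
     [w]. *)
  have [Wc' [BB' dWc' wWc']] := bose_burton_change_complement BB wW wW0.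
  rewrite dWc in dWc'; apply: leq_trans (aB _ BB' dWc').
  rewrite leq_mul2l card_shift_cap_le ?dWc' ?orbT //.
  by apply: contraNneq wW0 => ->; rewrite mem0v.
pose E := [set x in R | x \notin M].
have noBB' : ~ has_bose_burton M (\dim Wc).+1 (\dim V0) by rewrite dWc dV0.
(* By [regular_addition], [y + x] can fall outside [E] only by being irregular. *)
have defE x : x \in E -> (#|[set y in E | (y + x)%R \notin E]| <= r)%N.
  rewrite inE => /andP [xR xM]; rewrite /r -[leqRHS](card_translate _ x).
  apply: subset_leq_card; apply/fintype.subsetP => y.
  case/setIdP => /setIdP [yR yM] yxE; rewrite inE finset.in_setC.
  apply: contra yxE => yxR; apply/setIdP; split => //.
  exact: (regular_addition M0 BBV noBB').
(* Each translate [x + Wc] with [x] regular meets [E]. *)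
have RE : (#|R| <= 2 ^ k * #|E|)%N.
  rewrite -dWc -card_meet_translates -sum1_card big_mkcond /=.
  apply: leq_sum => x _; case: ifP => // xR.
  have [w wW xw] := regular_meets xR.
  rewrite card_gt0; apply/set0Pn; exists w; rewrite inE wW /= inE xw andbT.
  by apply: regular_translate xR; apply: (subvP (addvSr _ _)).
have cR : (#|R| + r = 2 ^ n)%N by rewrite /r cardsC -cardsT card_F2n.
have q0 : (0 < 2 ^ n)%N by rewrite expn_gt0.
have k0 : (0 < 2 ^ k)%N by rewrite expn_gt0.
have tr : (8 * (2 ^ k * r) <= 2 ^ n)%N.
  by apply: leq_trans br; rewrite mulnA leq_mul2r /b' leq_addl orbT.
have rt : (r <= 2 ^ k * r)%N by rewrite leq_pmull.
have r_small : (4 * r < #|E|)%N.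
  by rewrite -(ltn_pmul2l k0) mulnCA; lia.
have [F [EF FE]] := approximate_subspace defE r_small.
have EFle : (#|E| <= 2 ^ \dim F)%N.
  by rewrite -card_subspace; apply/subset_leq_card/fintype.subsetP => x /EF; rewrite inE.
exists F; split.
  apply/eqP; rewrite eqn_leq; apply/andP; split.
    (* [F] meets [Wc] trivially: two points of [E] that differ by a vector of [Wc] lie in one
       regular translate, so their difference is also in [V0]. *)
    rewrite -dWc -dimv_disjoint_sum; first by rewrite -[leqRHS](dimvf_rV n) dimvS ?subvf.
    apply/capv0P => v /FE [x]; rewrite inE => /andP [xR xM].
    rewrite inE => /andP [_ xvM] vW; apply: cap0 => //.
    have /regular_setP [/(_ 0 v)] := xR; rewrite addr0 add0r mem0v xM xvM.
    by rewrite (subvP (addvSr _ _) _ vW) => /(_ isT isT isT isT).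
  rewrite leqNgt; apply/negP => ltF.
  have : (2 * (2 ^ \dim F * 2 ^ k) <= 2 ^ n)%N by rewrite -expnD -expnS leq_exp2l.
  have : (2 ^ k * #|E| <= 2 ^ k * 2 ^ \dim F)%N by rewrite leq_mul2l EFle orbT.
  by rewrite [(2 ^ \dim F * _)%N]mulnC; lia.
have : (#|[set v | (v \notin M) && (v \notin F)]| + #|E| <= #|~: M|)%N.
  rewrite -cardsUI (_ : _ :&: _ = finset.set0) ?cards0 ?addn0.
    apply: subset_leq_card; apply/fintype.subsetP => v; rewrite !finset.inE.
    by move=> /orP [] /andP [].
  apply/setP => v; rewrite !inE; apply/negP => /and3P [/andP [_ vF] vR vM].
  by case/negP: vF; apply: EF; rewrite !inE vR.
set f := #|_| => fE; rewrite -(leq_pmul2l k0).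
(* The complement of [M] accounts for at most [2 ^ n] after scaling by [2 ^ k], and [E] for at least
   [#|R| = 2 ^ n - r] of it. *)
have : (2 ^ k * f <= r)%N.
  have : (2 ^ k * (f + #|E|) <= 2 ^ k * #|~: M|)%N by rewrite leq_mul2l fE orbT.
  by rewrite mulnDr; lia.
rewrite mulnCA => /(leq_mul (leqnn b)) /leq_trans; apply.
apply: leq_trans (leq_trans br _); first by rewrite leq_mul2r /b' leq_addr orbT.
by rewrite leq_pmull.
Qed.

(** * Restrictions and lifts *)

(** Complete a basis of [A] to one of [B] and send the new vectors to independent vectors in a
    complement of [f @: A] in [T]; the dimension hypothesis supplies enough of them. *)
Lemma linear_extension (K : fieldType) (aT rT : vectType K) (f : 'Hom(aT, rT))
    (A B : {vspace aT}) (T : {vspace rT}) :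
  (A <= B)%VS -> (A :&: lker f = 0)%VS -> (f @: A <= T)%VS -> (\dim B <= \dim T)%N ->
  exists g : 'Hom(aT, rT),
    [/\ {in A, g =1 f}, (B :&: lker g = 0)%VS & (g @: B <= T)%VS].
Proof.
move=> AB fA fT dBT.
set X := vbasis A ++ vbasis (B :\: A).
set Y := map f (vbasis A) ++ take (\dim (B :\: A)) (vbasis (T :\: (f @: A))).
have dfA := limg_dim_eq fA.
have dB : (\dim A + \dim (B :\: A) = \dim B)%N.
  by rewrite -(dimv_cap_compl B A) (capv_idPr AB).
have dT : (\dim A + \dim (T :\: f @: A) = \dim T)%N.
  by rewrite -(dimv_cap_compl T (f @: A)) (capv_idPr fT) dfA.
have sX : <<X>>%VS = B.
  rewrite span_cat !(span_basis (vbasisP _)) addvC addv_diff.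
  exact/addv_idPl.
have fX : free X.
  rewrite cat_free !(basis_free (vbasisP _)) !(span_basis (vbasisP _)) /=.
  by apply/directv_addP; rewrite capvC capv_diff.
have szY : size Y = size X.
  by rewrite !size_cat size_map size_take !size_tuple; case: ltnP => //; lia.
have bfA := limg_basis_of fA (vbasisP A).
have sY : (<<Y>> <= T)%VS.
  rewrite span_cat (span_basis bfA) subv_add fT /=; apply/span_subvP => y.
  by move=> /mem_take /vbasis_mem; apply: (subvP (diffvSl _ _)).
have fY : free Y.
  rewrite cat_free (basis_free bfA) (span_basis bfA) /=; apply/andP; split.
    apply: (@catl_free _ _ (drop (\dim (B :\: A)) (vbasis (T :\: f @: A)))).
    by rewrite cat_take_drop (basis_free (vbasisP _)).
  apply/directv_addP/eqP; rewrite -subv0 -(capv_diff T (f @: A)) capvC.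
  apply: capvS => //; apply/span_subvP => y /mem_take; exact: vbasis_mem.
have [g0 /(_ fX szY) Hg] := linear_of_free X Y.
have Hg' : map (linfun g0) X = Y.
  by rewrite -Hg; apply: eq_map => v; rewrite lfunE.
have imB : (linfun g0 @: B)%VS = <<Y>>%VS by rewrite -sX limg_span Hg'.
exists (linfun g0); split; last by rewrite imB.
- move=> v vA; apply/eqP; rewrite -subr_eq0 -opp_lfunE -add_lfunE -memv_ker.
  move: v vA; apply/subvP; rewrite -(span_basis (vbasisP A)); apply/span_subvP => v vA.
  rewrite memv_ker add_lfunE opp_lfunE subr_eq0; apply/eqP.
  move/eqP: Hg'; rewrite map_cat eqseq_cat ?size_map // => /andP [/eqP /eq_in_map Hv _].
  exact: Hv.
- apply/eqP; rewrite -dimv_eq0; apply/eqP.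
  have := limg_ker_dim (linfun g0) B; rewrite imB (eqP fY) szY -(eqP fX) sX.
  lia.
Qed.

Lemma exists_parametrization n p (F : {vspace 'rV['F_2]_n}) : \dim F = p ->
  exists phi : 'Hom('rV['F_2]_p, 'rV['F_2]_n), lker phi = 0%VS /\ limg phi = F.
Proof.
move=> dF; have [|||g [_ kg img]] := @linear_extension _ 'rV['F_2]_p _
  (0 : 'Hom('rV['F_2]_p, 'rV['F_2]_n)) 0%VS fullv F (sub0v _).
- by rewrite cap0v.
- by rewrite limg0 sub0v.
- by rewrite dimvf_rV dF.
exists g; rewrite capfv in kg; split => //; apply/eqP; rewrite eqEdim img /=.
by rewrite limg_dim_eq ?capfv ?kg // dimvf_rV dF.
Qed.

Lemma has_restrictionP k m (N : matroid k) (M : matroid m) :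
  has_restriction N M <-> exists f : 'Hom('rV['F_2]_k, 'rV['F_2]_m),
    lker f = 0%VS /\ forall v, v \in (N : {set _}) -> f v \in (M : {set _}).
Proof.
split=> [[X [XM [f [injf EX]]]]|[f [/eqP/lker0P injf fN]]].
  exists (linfun f); split=> [|v vN].
    by apply/eqP/lker0P => u v; rewrite !lfunE; apply: injf.
  by rewrite lfunE (fintype.subsetP XM) // -EX imset_f.
exists (f @: (N : {set _})); split; last by exists f.
by apply/fintype.subsetP => _ /imsetP [v vN ->]; apply: fN.
Qed.

Lemma has_restriction_refl k (N : matroid k) : has_restriction N N.
Proof.
apply/has_restrictionP; exists \1%VF; split=> [|v]; last by rewrite id_lfunE.
by apply/eqP/lker0P => u v; rewrite !id_lfunE.
Qed.

Lemma has_restriction_trans k l m (N : matroid k) (L : matroid l) (M : matroid m) :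
  has_restriction N L -> has_restriction L M -> has_restriction N M.
Proof.
move=> /has_restrictionP [f [/eqP/lker0P kf fN]] /has_restrictionP [g [/eqP/lker0P kg gL]].
apply/has_restrictionP; exists (g \o f)%VF; split=> [|v vN].
  by apply/eqP/lker0P => u v; rewrite !comp_lfunE => /kg /kf.
by rewrite comp_lfunE gL // fN.
Qed.

Lemma has_restriction_dim k m (N : matroid k) (M : matroid m) :
  has_restriction N M -> (k <= m)%N.
Proof.
case/has_restrictionP => f [kf _]; rewrite -[leqLHS]dimvf_rV -[leqRHS]dimvf_rV.
by rewrite -(@limg_dim_eq _ _ _ f) ?capfv ?kf // dimvS ?subvf.
Qed.

Lemma has_restriction_card k m (N : matroid k) (M : matroid m) :
  has_restriction N M -> (#|N| <= #|M|)%N.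
Proof.
case=> X [XM [f [injf EX]]].
by rewrite -(card_imset _ injf) EX subset_leq_card.
Qed.

(** Equal dimension and size make the embedding a linear bijection that carries [N] onto all of [M],
    so its inverse embeds back. *)
Lemma has_restriction_sym k m (N : matroid k) (M : matroid m) :
  has_restriction N M -> k = m -> #|M| = #|N| -> has_restriction M N.
Proof.
move=> /has_restrictionP [f [/eqP kf fN]] Ekm; case: m / Ekm M f kf fN => M f kf fN cMN.
apply/has_restrictionP; exists f^-1%VF; split.
  by apply/eqP/lker0P/(can_inj (lker0_lfunVK kf)).
have /eqP EM : f @: (N : {set _}) == M :> {set _}.
  rewrite eqEcard card_imset ?cMN ?leqnn ?andbT; last exact/lker0P.
  by apply/fintype.subsetP => _ /imsetP [v vN ->]; apply: fN.
by move=> v; rewrite -EM => /imsetP [u uN ->]; rewrite lker0_lfunK.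
Qed.

(* A matroid need not span, so a restriction map only has to be given on a
   subspace containing it. *)
Lemma has_restriction_partial k m (N : matroid k) (M : matroid m)
    (A : {vspace 'rV['F_2]_k}) (f : 'Hom('rV['F_2]_k, 'rV['F_2]_m)) :
  (k <= m)%N -> (forall v, v \in (N : {set _}) -> v \in A) -> (A :&: lker f = 0)%VS ->
  (forall v, v \in (N : {set _}) -> f v \in (M : {set _})) -> has_restriction N M.
Proof.
move=> km NA Af fN; have [|||g [gf kg _]] := @linear_extension _ _ _ f A fullv fullv _ Af.
- exact: subvf.
- exact: subvf.
- by rewrite !dimvf_rV.
apply/has_restrictionP; exists g; rewrite capfv in kg; split => // v vN.
by rewrite gf ?fN // NA.
Qed.

Lemma matroid_pullback p n (phi : 'Hom('rV['F_2]_p, 'rV['F_2]_n)) (M : matroid n) :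
  exists M0 : matroid p, forall v, (v \in (M0 : {set _})) = (phi v \in (M : {set _})).
Proof.
have nz : 0 \notin [set v | phi v \in (M : {set _})].
  by rewrite inE linear0 (negPf (mset_nz M)).
by exists (Matroid nz) => v; rewrite inE.
Qed.

Lemma exists_lift_along p n t (phi : 'Hom('rV['F_2]_p, 'rV['F_2]_n)) (M0 : matroid p) :
  lker phi = 0%VS -> (p + t)%N = n ->
  exists M : matroid n, is_lift M0 t M /\
    forall v, (v \in (M : {set _})) = (v \notin limg phi) || (v \in phi @: (M0 : {set _})).
Proof.
move=> kphi ptn; have inj : injective phi by apply/lker0P/eqP.
pose S := [set v | (v \notin limg phi) || (v \in phi @: (M0 : {set _}))].
have nz : 0 \notin S.
  rewrite inE mem0v /=; apply: contra (mset_nz M0) => /imsetP [v vM0 /esym/eqP].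
  by rewrite -memv_ker kphi memv0 => /eqP <-.
exists (Matroid nz); split; last by move=> v; rewrite inE.
split; first by rewrite ptn.
exists (limg phi); split.
- by rewrite limg_dim_eq ?capfv // dimvf_rV.
- split; first by apply/fintype.subsetP => v; rewrite inE => /andP [].
  exists phi; split => //; apply/setP => v; rewrite !inE.
  apply/idP/idP => [vM|/andP [/orP [/negPf ->|]]] //.
  by rewrite vM orbT; case/imsetP: vM => u _ ->; rewrite memv_img ?memvf.
- by move=> v vphi; rewrite inE vphi.
Qed.

Lemma card_outside n (F : {vspace 'rV['F_2]_n}) (A : {set 'rV['F_2]_n}) :
  (#|A| + #|[set v | (v \notin A) && (v \notin F)]| + 2 ^ \dim F
     = #|[set v in A | v \in F]| + 2 ^ n)%N.
Proof.
have := cardsID [set v | v \in F] A.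
have := cardsID A (~: [set v | v \in F]).
have := cardsC [set v | v \in F]; rewrite -cardsT card_F2n card_subspace.
have -> : [set v in A | v \in F] = A :&: [set v | v \in F].
  by apply/setP => v; rewrite !inE.
have -> : [set v | (v \notin A) && (v \notin F)] = ~: [set v | v \in F] :\: A.
  by apply/setP => v; rewrite !inE.
have -> : A :\: [set v | v \in F] = ~: [set v | v \in F] :&: A.
  by apply/setP => v; rewrite !inE.
move=> <- <- <-; rewrite -!addnA; congr (_ + _)%N; rewrite addnA; exact: addnC.
Qed.

Lemma card_lift m n t (N : matroid m) (M : matroid n) : is_lift N t M ->
  (#|M| + 2 ^ (n - t) = #|N| + 2 ^ n)%N.
Proof.
move=> [_ [F [dF [_ [f [injf EF]]] HF]]].
have := card_outside F M; rewrite -EF card_imset //.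
rewrite (_ : [set v | _] = finset.set0).
  by rewrite cards0 addn0 -[X in (X - t)%N]dF addnK.
apply/setP => v; rewrite !inE; apply/negP => /andP [vM vF].
by case/negP: vM; apply: HF.
Qed.

(** * The decomposition family *)

Lemma critical_number_leq m (N : matroid m) c :
  avoided_in_codim N c -> (critical_number N <= c)%N.
Proof.
by rewrite /critical_number; case: ex_minnP => c0 _ Hmin /asboolP; apply: Hmin.
Qed.

Lemma critical_number_avoided m (N : matroid m) :
  avoided_in_codim N (critical_number N).
Proof. by rewrite /critical_number; case: ex_minnP => c0 /asboolP. Qed.

Lemma critical_number_leq_dim m (N : matroid m) : (critical_number N <= m)%N.
Proof.
have [U [dU _]] := critical_number_avoided N.
by rewrite -[leqRHS]dU leq_addl.
Qed.

(** Take [U] of codimension [j] avoided by [N]; map [U] onto some [G] inside [W0] and the whole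
    space into [G + Wc]. Vectors outside [U] land outside [G], hence in [M]. *)
Lemma bose_burton_has_restriction m n j d (N : matroid m) (M : matroid n) :
  critical_number N = j -> (m <= d + j)%N -> has_bose_burton M j d ->
  has_restriction N M.
Proof.
move=> Ej md [W0 [Wc [BB dW0 dWc]]].
have := critical_number_avoided N; rewrite Ej => -[U [dU NU]].
have [|G GW0 dG] := @exists_subspace _ W0 (\dim U); first by rewrite dW0; lia.
have [capG HM] := bose_burton_sub GW0 (subvv Wc) BB.
have [|||g [_ kg gU]] := @linear_extension _ 'rV['F_2]_m _
  (0 : 'Hom('rV['F_2]_m, 'rV['F_2]_n)) 0%VS U G (sub0v _).
- by rewrite cap0v.
- by rewrite limg0 sub0v.
- by rewrite dG.
have [||h [hg kh hK]] := @linear_extension _ _ _ g U fullv (G + Wc)%VS (subvf _) kg.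
- exact: subv_trans gU (addvSl _ _).
- by rewrite dimvf_rV dimv_disjoint_sum // dG dWc dU.
rewrite capfv in kh; apply/has_restrictionP; exists h; split => // v vN.
apply: HM; first by rewrite (subvP hK) // memv_img ?memvf.
apply: contra (NU v vN) => hvG.
have gUG : (g @: U)%VS = G by apply/eqP; rewrite eqEdim gU (limg_dim_eq kg) dG leqnn.
move: hvG; rewrite -gUG => /memv_imgP [u uU]; rewrite -hg //.
by have /eqP/lker0P inj := kh; move/inj => ->.
Qed.

(* Choose the missing [k] dimensions of [K] one at a time; the few vectors
   outside [F] that are not in [M] cannot block every choice. *)
Lemma extend_outside n k (M : {set 'rV['F_2]_n}) (F S : {vspace 'rV['F_2]_n}) :
  (\dim F + k)%N = n -> (S <= F)%VS ->
  (2 * 2 ^ (\dim S + k) * #|[set v | (v \notin M) && (v \notin F)]| < 2 ^ n)%N ->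
  exists K : {vspace 'rV['F_2]_n},
    [/\ (S <= K)%VS, \dim K = (\dim S + k)%N &
        forall v, v \in K -> v \notin S -> v \in M].
Proof.
move=> dF SF; set X := [set v | _] => smallX.
(* The added equation [F :&: K = S] determines the dimension of [F + K], which stays below [n] until
   [k] steps are done. *)
suff [K [SK dK _ KM]] : exists K : {vspace 'rV['F_2]_n},
    [/\ (S <= K)%VS, \dim K = (\dim S + k)%N, (F :&: K = S)%VS &
        forall v, v \in K -> v \notin S -> v \in M] by exists K.
have: (k <= k)%N by []; elim: {1 3}k => [|j IH] jk.
  exists S; split; rewrite ?addn0 ?subvv //; first exact/capv_idPr.
  by move=> v ->.
have [K [SK dK FK KM]] := IH (ltnW jk).
have dFK : \dim (F + K) = (\dim F + j)%N.
  by have := dimv_sum_cap F K; rewrite FK dK; lia.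
(* A blocked [v] has [v + u] in [X] for some [u] in [K]; this excludes fewer than half of all
   vectors, while at least half lie outside [F + K]. *)
have [v vFK vK] : exists2 v, v \notin (F + K)%VS & forall u, u \in K -> u + v \in M.
  apply: contrapT => nov; move: smallX; rewrite ltnNge => /negP; apply.
  have sub : ~: [set v | v \in (F + K)%VS] \subset
      \bigcup_(u in [set u | u \in K]) [set v | v + u \in X].
    apply/fintype.subsetP => v; rewrite !inE => vFK; apply: contrapT => /negP vX.
    apply: nov; exists v => // u uK; apply/negPn/negP => uvM.
    case/negP: vX; apply/finset.bigcupP; exists u; rewrite !inE //.
    rewrite addrC uvM /=; apply: contra vFK => uvF.
    by rewrite -(addKv2 v u) (addrC v) memv_add.
  have := leq_trans (subset_leq_card sub) (leq_card_bigcup _ _).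
  under eq_bigr do rewrite card_translate.
  rewrite sum_nat_const card_subspace dK.
  have := cardsC [set v | v \in (F + K)%VS]; rewrite -cardsT card_F2n card_subspace dFK.
  have : (2 * 2 ^ (\dim F + j) <= 2 ^ n)%N by rewrite -expnS leq_exp2l //; lia.
  have : (2 ^ (\dim S + j) * #|X| <= 2 ^ (\dim S + k) * #|X|)%N.
    by rewrite leq_mul2r leq_exp2l // leq_add2l (ltnW jk) orbT.
  rewrite -mulnA; lia.
have vnK : v \notin K by apply: contra vFK; apply: (subvP (addvSr _ _)).
exists (K + <[v]>)%VS; split.
- exact: subv_trans SK (addvSl _ _).
- by rewrite dim_add_line // dK addnS.
- apply/eqP; rewrite eqEsubv subv_cap SF (subv_trans SK (addvSl _ _)) !andbT.
  apply/subvP => w /memv_capP [wF /mem_add_line [wK|[u uK Ew]]].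
    by rewrite -FK memv_cap wF.
  case/negP: vFK; have -> : v = w + u by rewrite Ew addrC addrA addvv2 add0r.
  exact: memv_add.
- by move=> w /mem_add_line [/KM //|[u uK ->] _]; apply: vK.
Qed.

(** The embedding is built in three stages: the copy of [D] in [FL] goes into [M] through [M0], then
    [FL] into [limg phi], then the whole space into a [K] from [extend_outside], so that vectors
    outside [FL] land in [M]. *)
Lemma lift_has_restriction n p m k d (M : matroid n) (M0 : matroid p)
    (phi : 'Hom('rV['F_2]_p, 'rV['F_2]_n)) (D : matroid d) (L : matroid m) :
  lker phi = 0%VS -> (p + k)%N = n -> (m <= n)%N ->
  (forall v, v \in (M0 : {set _}) -> phi v \in (M : {set _})) ->
  (2 * 2 ^ m * #|[set v | (v \notin (M : {set _})) && (v \notin limg phi)]| < 2 ^ n)%N ->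
  is_lift D k L -> has_restriction D M0 -> has_restriction L M.
Proof.
move=> kphi pk mn phiM smallX [dkm [FL [dFL [_ [g0 [injg0 EL]]] HL]]].
move=> /has_restrictionP [r [/eqP/lker0P injr rD]].
have inj_phi : injective phi by apply/lker0P/eqP.
pose g := linfun g0.
have injg : lker g == 0%VS by apply/lker0P => u v; rewrite !lfunE; apply: injg0.
pose LF := [set v in (L : {set _}) | v \in FL].
have LFg v : v \in LF -> exists2 u, u \in (D : {set _}) & v = g u.
  by rewrite /LF -EL => /imsetP [u uD ->]; exists u; rewrite ?lfunE.
(* The range of [g] need not be inside [FL], so the first stage is restricted to the span of the
   copy of [D]. *)
pose A := <<enum LF>>%VS.
have AFL : (A <= FL)%VS.
  by apply/span_subvP => v; rewrite mem_enum inE => /andP [].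
have Ag : (A <= limg g)%VS.
  by apply/span_subvP => v; rewrite mem_enum => /LFg [u _ ->]; rewrite memv_img ?memvf.
pose f := (phi \o r \o g^-1)%VF.
have kf : (A :&: lker f = 0)%VS.
  apply/capv0P => v /(subvP Ag) /memv_imgP [u _ ->].
  rewrite memv_ker !comp_lfunE lker0_lfunK // => /eqP Eu.
  suff -> : u = 0 by rewrite linear0.
  by apply/injr/inj_phi; rewrite Eu !linear0.
have dphi : \dim (limg phi) = p by rewrite limg_dim_eq ?capfv // dimvf_rV.
have [||g1 [g1f kg1 img1]] := @linear_extension _ _ _ f A FL (limg phi) AFL kf.
- by rewrite !limg_comp limgS ?subvf.
- by rewrite dphi -(leq_add2r k) dFL pk.
have dS : \dim (g1 @: FL) = \dim FL by rewrite limg_dim_eq.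
have [||K [SK dK KM]] := @extend_outside n k M (limg phi) (g1 @: FL)%VS _ img1 _.
- by rewrite dphi.
- by rewrite dS dFL.
have [||g2 [g2g kg2 img2]] := @linear_extension _ _ _ g1 FL fullv K (subvf _) kg1.
- exact: SK.
- by rewrite dimvf_rV dK dS dFL.
rewrite capfv in kg2; apply/has_restrictionP; exists g2; split => // v vL.
have [vFL|vFL] := boolP (v \in FL).
  have vLF : v \in LF by rewrite inE vL.
  have [u uD Ev] := LFg _ vLF.
  rewrite g2g // g1f; last by apply: memv_span; rewrite mem_enum.
  by rewrite !comp_lfunE Ev lker0_lfunK //; apply/phiM/rD.
apply: KM; first by rewrite (subvP img2) ?memv_img ?memvf.
apply: contra vFL => /memv_imgP [u uFL]; rewrite -g2g //.
by have /eqP/lker0P inj := kg2; move/inj => ->.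
Qed.

(** Descent on dimension plus size: by [has_restriction_sym], a restriction that is not mutual makes
    this sum drop. *)
Lemma exists_minimal_decomposing (Ns : set anyMatroid) k (D : anyMatroid) :
  decomposing Ns k D -> exists D' : anyMatroid,
    decomposition_family Ns k D' /\ has_restriction (tagged D') (tagged D).
Proof.
have [s] := ubnP (tag D + #|tagged D|)%N; elim: s D => // s IH D Ds Ddec.
have [Dmin|nDmin] := pselect (decomposition_family Ns k D).
  by exists D; split => //; apply: has_restriction_refl.
have [D' [D'dec [D'D nDD']]] : exists D' : anyMatroid, decomposing Ns k D' /\
    (has_restriction (tagged D') (tagged D) /\ ~ has_restriction (tagged D) (tagged D')).
  apply: contrapT => H; apply: nDmin; split=> // D' D'dec D'D.
  by apply: contrapT => nDD'; apply: H; exists D'.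
have lt : (tag D' + #|tagged D'| < tag D + #|tagged D|)%N.
  have le1 := has_restriction_dim D'D; have le2 := has_restriction_card D'D.
  rewrite ltnNge; apply/negP => ge.
  have [E1 E2] : tag D' = tag D /\ #|tagged D| = #|tagged D'| by lia.
  by apply: nDD'; apply: has_restriction_sym.
have [|D'' [D''min D''D']] := IH D' _ D'dec; first by apply: leq_trans lt _.
by exists D''; split => //; apply: has_restriction_trans D'D.
Qed.

(** For a copy of [N] in [M], the preimage of [F] has codimension at most [k]. The part [D] of [N]
    in a subspace of it of codimension exactly [k] is decomposing and is a restriction of [M0]. *)
Lemma lift_family_free (Ns : set anyMatroid) k n p (M0 : matroid p) (M : matroid n) :
  (forall N : anyMatroid, Ns N -> (k <= tag N)%N) -> (p + k)%N = n ->
  family_free (decomposition_family Ns k) M0 -> is_lift M0 k M ->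
  family_free Ns M.
Proof.
move=> kNs pk freeM0 [_ [F [dF [_ [f0 [injf0 EF]]] HF]]] N NsN.
move=> NM; have mn := has_restriction_dim NM.
have /has_restrictionP [g [kg gN]] := NM.
have km := kNs N NsN; have /eqP/lker0P injg := kg.
have dE : (tag N - k <= \dim (g @^-1: F))%N.
  have := dimv_sum_cap F (limg g); have := dimvS (subvf (F + limg g)%VS).
  have := limg_ker_dim g (g @^-1: F)%VS.
  have -> : (g @: (g @^-1: F) = F :&: limg g)%VS.
    apply/eqP; rewrite eqEsubv; apply/andP; split; apply/subvP => v.
      case/memv_imgP => u; rewrite -memv_preim => gu ->.
      by rewrite memv_cap gu memv_img ?memvf.
    by case/memv_capP => vF /memv_imgP [u _ Ev]; rewrite Ev memv_img // -memv_preim -Ev.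
  rewrite kg capv0 dimv0 dimvf_rV (@limg_dim_eq _ _ _ g fullv) ?capfv // dimvf_rV.
  move: dF; move: (\dim F) (\dim (F + _)) (\dim (F :&: _)) (\dim (_ @^-1: _)).
  lia.
have [E EF' dE'] := exists_subspace dE.
have [e [ke ime]] := exists_parametrization dE'.
have [D HD] := matroid_pullback e (tagged N).
have [L [liftL HL]] := @exists_lift_along _ (tag N) k e D ke (subnK km).
have Ddec : decomposing Ns k (existT _ _ D).
  exists N; split => //; exists L; split => //.
  apply/has_restrictionP; exists \1%VF; split.
    by apply/eqP/lker0P => u v; rewrite !id_lfunE.
  move=> v vN; rewrite id_lfunE HL.
  case: (boolP (v \in limg e)) => //= /memv_imgP [u _ Ev].
  by rewrite Ev imset_f // HD -Ev.
have [D' [D'min D'D]] := exists_minimal_decomposing Ddec.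
apply: (freeM0 D' D'min); apply: has_restriction_trans D'D _ => /=.
pose f := linfun f0.
have kf : lker f == 0%VS by apply/lker0P => u v; rewrite !lfunE; apply: injf0.
have Df v : v \in (D : {set _}) -> exists2 u, u \in (M0 : {set _}) & g (e v) = f u.
  rewrite HD => evN; have : g (e v) \in [set v in (M : {set _}) | v \in F].
    rewrite inE gN //= memv_preim (subvP EF') // -ime memv_img ?memvf //.
  by rewrite -EF => /imsetP [u uM0 ->]; exists u; rewrite ?lfunE.
(* The range of [f] need not be [F], so its inverse is used only on the image of the span of [D]. *)
apply: (@has_restriction_partial _ _ D M0 <<enum (D : {set _})>>%VS (f^-1 \o g \o e)%VF).
- by lia.
- by move=> v vD; apply: memv_span; rewrite mem_enum.
- have sub : (<<enum (D : {set _})>> <= (g \o e) @^-1: limg f)%VS.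
    apply/span_subvP => v; rewrite mem_enum => /Df [u _ Eu].
    by rewrite -memv_preim comp_lfunE Eu memv_img ?memvf.
  apply/capv0P => v /(subvP sub); rewrite -memv_preim memv_ker !comp_lfunE => vf.
  move=> /eqP /(congr1 f); rewrite limg_lfunVK // linear0 => gev.
  have /eqP/lker0P inje := ke.
  by apply/inje/injg; rewrite gev !linear0.
- by move=> v /Df [u uM0 Eu]; rewrite !comp_lfunE Eu lker0_lfunK.
Qed.

(** If [D] were empty, [L] would avoid [F], and [F] pulled back along the embedding of [N] would
    show that the critical number of [N] is at most [k]. *)
Lemma decomposing_nonempty (Ns : set anyMatroid) k (D : anyMatroid) :
  (forall N : anyMatroid, Ns N -> (k < critical_number (tagged N))%N) ->
  decomposing Ns k D -> tagged D != finset.set0 :> {set _}.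
Proof.
move=> kNs [N [NsN [L [[_ [F [dF [_ [f0 [_ EF]]] _]]] NL]]]].
apply/eqP => D0; have := kNs N NsN; rewrite ltnNge => /negP; apply.
have /has_restrictionP [h [/eqP kh hN]] := NL.
apply: critical_number_leq; exists (h^-1 @: F)%VS; split.
  rewrite limg_dim_eq //; apply/capv0P => v _; rewrite memv_ker => /eqP /(congr1 h).
  by rewrite lker0_lfunVK // linear0.
move=> v vN; apply/negP => /memv_imgP [y yF Ev].
have : y \in [set v in (L : {set _}) | v \in F].
  by rewrite inE yF andbT -(lker0_lfunVK kh y) -Ev hN.
by rewrite -EF D0 imset0 inE.
Qed.

(** * Extremal numbers and extremal matroids *)

Lemma finite_family_dim_bound (Ns : set anyMatroid) : finite_set Ns ->
  exists m : nat, forall N : anyMatroid, Ns N -> (tag N <= m)%N.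
Proof.
move=> /(finite_image (@tag _ _)) /finite_seqP [s Es].
exists (\max_(i <- s) i)%N => N NsN; apply: leq_bigmax_seq => //.
have : ((@tag _ _) @` Ns)%classic (tag N) by exists N.
by rewrite Es.
Qed.

Lemma extremal_number_geq (Ns : set anyMatroid) n (M : matroid n) :
  family_free Ns M -> (#|M| <= extremal_number Ns n)%N.
Proof. by move=> freeM; apply: leq_bigmax_cond; apply/asboolP. Qed.

Lemma exists_extremal (Ns : set anyMatroid) n (M : matroid n) :
  family_free Ns M -> exists M' : matroid n, extremal Ns M'.
Proof.
move=> freeM.
have [|M' /asboolP freeM' EM'] := @eq_bigmax_cond _
  [pred M : matroid n | `[< family_free Ns M >]] (fun M : matroid n => #|M|).
  by apply/card_gt0P; exists M; apply/asboolP.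
by exists M'; split => //; rewrite -EM'.
Qed.

Lemma isomorphic_refl n (M : matroid n) : isomorphic M M.
Proof.
exists (@idfun 'rV['F_2]_n); split; first by exists id.
exact: imset_id.
Qed.

Lemma isomorphic_has_restriction n (M M' : matroid n) :
  isomorphic M M' -> has_restriction M M' /\ #|M| = #|M'|.
Proof.
move=> [f [/bij_inj injf EM]].
have cM : #|M| = #|M'| by rewrite -EM card_imset.
split => //; apply: has_restriction_sym => //.
by exists M; split => //; exists f.
Qed.

(** Here [N1], of critical number [k + 1], excludes geometries with [k + 1] levels, so [stability]
    applies. The final equation keeps the number of points missing outside [F], which decides the
    case of equality. *)
Lemma section_of_dense_free (Ns : set anyMatroid) (k : nat) :
  finite_set Ns -> is_min_critical_number Ns k.+1 ->
  exists n0 : nat, forall n, (n0 <= n)%N -> forall M : matroid n,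
    family_free Ns M -> (2 ^ n <= #|M| + 2 ^ (n - k))%N ->
  exists (M0 : matroid (n - k)) (F : {vspace 'rV['F_2]_n}),
    [/\ family_free (decomposition_family Ns k) M0,
        (\dim F + k)%N = n,
        restriction_of M0 M [set v in (M : {set _}) | v \in F] &
        (#|M| + #|[set v | (v \notin (M : {set _})) && (v \notin F)]| + 2 ^ (n - k)
           = #|M0| + 2 ^ n)%N].
Proof.
move=> /finite_family_dim_bound [m mNs] [[N1 [NsN1 chiN1]] kNs].
(* The factor [4] leaves room for the strict inequality with factor [2] in [lift_has_restriction],
   for all members of dimension at most [m]. *)
have [N HN] := stability k m (4 * 2 ^ m).
exists (N + m + k)%N => n n_large M freeM denseM.
have kn : (k <= n)%N by lia.
have noBB : ~ has_bose_burton M k.+1 m.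
  move=> BB; apply: (freeM N1 NsN1).
  apply: bose_burton_has_restriction chiN1 _ BB.
  exact: leq_trans (mNs _ NsN1) (leq_addr _ _).
have [||F [dF smallX]] := HN n M _ (mset_nz M) _ noBB; first by lia.
  have := cardsC (M : {set _}); rewrite -cardsT card_F2n => cM.
  have -> : (2 ^ n = 2 ^ k * 2 ^ (n - k))%N by rewrite -expnD subnKC.
  by rewrite leq_mul2l; apply/orP; right; lia.
have dF' : \dim F = (n - k)%N by rewrite -[X in (X - k)%N]dF addnK.
have [phi [kphi imphi]] := exists_parametrization dF'.
have [M0 HM0] := matroid_pullback phi M.
have injphi : injective phi by apply/lker0P/eqP.
have EM0 : phi @: (M0 : {set _}) = [set v in (M : {set _}) | v \in F].
  apply/setP => v; rewrite inE; apply/imsetP/andP => [[u + ->]|[vM]].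
    by rewrite HM0 -imphi memv_img ?memvf.
  by rewrite -imphi => /memv_imgP [u _ Ev]; exists u; rewrite // HM0 -Ev.
exists M0, F; split => //.
- move=> D [[N' [NsN' [L [liftL N'L]]]] _] DM0; apply: (freeM N' NsN').
  apply: has_restriction_trans N'L _; have mN' := mNs N' NsN'.
  apply: (lift_has_restriction kphi _ _ _ _ liftL DM0).
  + by rewrite subnK.
  + by lia.
  + by move=> v; rewrite HM0.
  + rewrite imphi; set X := #|_| in smallX *.
    have : (2 ^ tag N' * X <= 2 ^ m * X)%N by rewrite leq_mul2r leq_exp2l // mN' orbT.
    by move: smallX (expn_gt0 2 n); rewrite -!mulnA; lia.
- split; first by apply/fintype.subsetP => v; rewrite inE => /andP [].
  by exists phi.
- by have := card_outside F M; rewrite dF' -EM0 card_imset.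
Qed.

Theorem theorem4p2 (Ns : set anyMatroid) (k : nat)
    (finNs : finite_set Ns) (hk : is_min_critical_number Ns k.+1) :
  exists n0 : nat, forall n : nat, (n0 <= n)%N ->
    (extremal_number Ns n)%:R = 2 ^+ n * (1 - 2 ^- k)
                   + (extremal_number (decomposition_family Ns k) (n - k))%:R :> rat
    /\
    forall M : matroid n,
      extremal Ns M <->
      exists M0 : matroid (n - k),
        extremal (decomposition_family Ns k) M0 /\
        exists M' : matroid n, is_lift M0 k M' /\ isomorphic M M'.
Proof.
have [n0 Hn0] := section_of_dense_free finNs hk.
have [_ kNs] := hk.
have kdim (N : anyMatroid) : Ns N -> (k <= tag N)%N.
  by move/kNs/leq_trans/(_ (critical_number_leq_dim _))/ltnW.
exists (n0 + k)%N => n n_large; set Ds := decomposition_family Ns k.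
have kn : (k <= n)%N by lia.
have lift_free (M0 : matroid (n - k)) (M : matroid n) :
    extremal Ds M0 -> is_lift M0 k M ->
    family_free Ns M /\ (#|M| + 2 ^ (n - k) = extremal_number Ds (n - k) + 2 ^ n)%N.
  move=> [freeM0 <-] liftM; split; last exact: card_lift liftM.
  exact: lift_family_free kdim (subnK kn) freeM0 liftM.
(* The empty matroid is free of [Ds], so the maximum is attained by a free matroid and is not the
   default [0]. *)
have [M0 exM0] : exists M0 : matroid (n - k), extremal Ds M0.
  have nz : 0 \notin (finset.set0 : {set 'rV['F_2]_(n - k)}) by rewrite inE.
  apply: (@exists_extremal _ _ (Matroid nz)) => D [Ddec _] /has_restrictionP [f [_ fD]].
  have /set0Pn [v vD] := decomposing_nonempty kNs Ddec.
  by have := fD v vD; rewrite inE.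
have [|F1 _ dF1] := @exists_subspace n fullv (n - k).
  by rewrite dimvf_rV leq_subr.
have [phi [kphi _]] := exists_parametrization dF1.
have [M1 [liftM1 _]] := exists_lift_along M0 kphi (subnK kn).
have [freeM1 cM1] := lift_free M0 M1 exM0 liftM1.
(* The lift [M1] bounds [#|M|] from below and the section [M2] from above, with the same value;
   hence no point outside [F] is missing and [M2] is extremal. *)
have upper (M : matroid n) : extremal Ns M ->
    (#|M| + 2 ^ (n - k) = extremal_number Ds (n - k) + 2 ^ n)%N /\
    exists M0 : matroid (n - k), extremal Ds M0 /\ is_lift M0 k M.
  move=> [freeM cM]; have leM1 := extremal_number_geq freeM1; rewrite -cM in leM1.
  have [||M2 [F [freeM2 dF resM2 cM2]]] := Hn0 n _ M freeM; [lia|lia|].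
  have := extremal_number_geq freeM2; rewrite -/Ds => leM2.
  have [X0 cM2' cM'] : [/\ #|[set v | (v \notin (M : {set _})) && (v \notin F)]| = 0%N,
      #|M2| = extremal_number Ds (n - k)
      & (#|M| + 2 ^ (n - k) = extremal_number Ds (n - k) + 2 ^ n)%N].
    by split; lia.
  split => //; exists M2; split => //; split; first by rewrite subnK.
  exists F; split => // v vF; apply/negPn/negP => vM.
  by have /eqP := X0; rewrite cards_eq0 => /eqP/setP/(_ v); rewrite !inE vM vF.
have [Mx exMx] := exists_extremal freeM1.
have exE : (extremal_number Ns n + 2 ^ (n - k) = extremal_number Ds (n - k) + 2 ^ n)%N.
  by have [<- _] := upper Mx exMx; case: exMx => _ ->.
split.
  have /(congr1 (fun x : nat => x%:R : rat)) := exE.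
  rewrite !natrD !natrX => E.
  have E2 : 2 ^+ n * 2 ^- k = 2 ^+ (n - k) :> rat.
    by rewrite -{1}(subnK kn) exprD mulfK // expf_neq0.
  apply: (addIr (2 ^+ (n - k))); rewrite E mulrBr mulr1 E2.
  by rewrite addrAC subrK addrC.
move=> M; split=> [exM|[M2 [exM2 [M' [liftM' isoM]]]]].
  have [_ [M2 [exM2 liftM2]]] := upper M exM.
  by exists M2; split => //; exists M; split => //; apply: isomorphic_refl.
have [freeM' cM'] := lift_free M2 M' exM2 liftM'.
have [MM' cMM'] := isomorphic_has_restriction isoM.
split; last by rewrite cMM'; lia.
by move=> N NsN NM; apply: (freeM' N NsN); apply: has_restriction_trans NM MM'.
Qed.
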